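(* Let $S \subseteq [0,1]$ be a perfect set. Then Alice has a winning strategy in the infinite real number game with target set $S$.
   Context: The infinite real number game with target set $S\subseteq[0,1]$: set $a_0 = 0$ and $b_0 = 1$. Two players, Alice and Bob, alternately choose real numbers, each knowing all previous moves. In round $n \ge 1$, Alice first chooses a real number $a_n$ with $a_{n-1} < a_n < b_{n-1}$, and then Bob chooses a real number $b_n$ with $a_n < b_n < b_{n-1}$. The play continues through all rounds $n = 1, 2, 3, \ldots$. The sequence $(a_n)$ is increasing and bounded above, so $\alpha = \lim_{n\to\infty} a_n$ exists and is a real number between $0$ and $1$. Alice wins if $\alpha \in S$, and Bob wins if $\alpha \notin S$. A strategy for a player is a rule assigning a legal move to each finite history of legal moves at which it is that player's turn. It is a winning strategy if that player wins every infinite play in which all of that player's moves follow the rule, whatever legal moves the opponent makes. For $X \subseteq [0,1]$, a limit point of $X$ is a point $x \in [0,1]$ such that for every $\epsilon > 0$ the open interval $(x-\epsilon, x+\epsilon)$ contains an element of $X$ other than $x$. The set $X$ is closed if every limit point of $X$ belongs to $X$. The set $X$ is perfect if it is non-empty, closed, and every element of $X$ is a limit point of $X$. *)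

(* Defs.v *)
From HB Require Import structures.
From mathcomp Require Import all_boot all_order all_algebra.
From mathcomp Require Import all_classical all_reals all_analysis.

Set Implicit Arguments.
Unset Strict Implicit.
Unset Printing Implicit Defensive.

Import Order.TTheory GRing.Theory Num.Theory.
Import numFieldNormedType.Exports.

Local Open Scope classical_set_scope.
Local Open Scope ring_scope.

Section Game.
Variable R : realType.
Implicit Types (p q : R * R) (h : seq (R * R)) (a b : nat -> R).

(* [p] is the pair (a_(n-1), b_(n-1)) and [q] the pair (a_n, b_n). *)
Definition legal_round p q : bool := [&& p.1 < q.1, q.1 < q.2 & q.2 < p.2].

(* A history at which it is Alice's turn is the chronological list of the
   completed rounds (a_1, b_1), ..., (a_(n-1), b_(n-1)); the initial pair
   (a_0, b_0) = (0, 1) is not recorded in it. *)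
Definition legal_history h : bool := path legal_round (0, 1) h.

(* The values of [sigma] on lists that are not legal histories are irrelevant
   junk, since [follows] below only evaluates [sigma] on legal histories. *)
Definition alice_strategy (sigma : seq (R * R) -> R) : Prop :=
  forall h, legal_history h ->
    (last (0, 1) h).1 < sigma h < (last (0, 1) h).2.

Definition play a b : Prop :=
  [/\ a 0%N = 0, b 0%N = 1 &
      forall n, legal_round (a n, b n) (a n.+1, b n.+1)].

Definition history a b (n : nat) : seq (R * R) :=
  mkseq (fun i => (a i.+1, b i.+1)) n.

Definition follows (sigma : seq (R * R) -> R) a b : Prop :=
  forall n, a n.+1 = sigma (history a b n).

Definition alice_wins (S : set R) a : Prop := S (limn a).

Definition alice_winning_strategy (S : set R) (sigma : seq (R * R) -> R) :
    Prop :=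
  alice_strategy sigma /\
  forall a b, play a b -> follows sigma a b -> alice_wins S a.

(* [limn] is a total operator: this is why it denotes a genuine limit in
   [alice_wins]. *)
Lemma play_cvg a b : play a b -> cvgn a.
Proof.
move=> [_ b0 ab].
have ltab n : (0 < n)%N -> a n < b n.
  by case: n => // n _; case/and3P: (ab n).
have leb n : b n <= 1.
  elim: n => [|n IH]; first by rewrite b0.
  by apply: le_trans IH; case/and3P: (ab n) => _ _ /ltW.
apply: nondecreasing_is_cvgn.
  by apply/nondecreasing_seqP => n; case/and3P: (ab n) => /ltW.
exists 1 => _ [n _ <-].
apply: (@le_trans _ _ (a n.+1)); first by case/and3P: (ab n) => /ltW.
exact: le_trans (ltW (ltab _ _)) (leb _).
Qed.

Lemma history_legal a b n : play a b -> legal_history (history a b n).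
Proof.
move=> [a0 b0 ab]; rewrite /legal_history /history.
apply/(pathP (0, 1)) => i; rewrite size_mkseq => lin.
rewrite nth_mkseq //; case: i lin => [|i] lin /=.
  by have := ab 0%N; rewrite a0 b0.
by rewrite nth_mkseq ?(ltnW lin)//; exact: ab.
Qed.

End Game.

(* Main.v *)
Require Import Defs.
From mathcomp Require Import all_boot all_order all_algebra.
From mathcomp Require Import all_classical all_reals all_analysis.

Import Order.TTheory GRing.Theory Num.Theory.
Import numFieldNormedType.Exports.

Local Open Scope classical_set_scope.
Local Open Scope ring_scope.

(** Alice only plays points of S at which S accumulates from the right.  When
    a_n is such a point, S still meets the interval ]a_n, b_n[, however small
    Bob makes it; and an open interval that meets a perfect set S always
    contains a point at which S accumulates from the right
    ([right_limit_in_itv]), so Alice can go on.  The interval ]0, 1[ meets S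
    to begin with, as a non-empty S inside [0, 1] without isolated points is not
    contained in {0, 1}.
    All her moves then lie in S, and so does their limit, S being closed.

    To find such a point in the interval, take two points t < s of S in it.
    If S does not accumulate at t from the right, t is the left end of a gap
    of S, and the right end of this gap is a point of S not exceeding s; it is
    not isolated and has nothing of S just before it, so S accumulates at it
    from the right ([right_limit_between]). *)

Definition right_limit_point {R : realType} (S : set R) : set R :=
  [set c | S c /\ forall d, c < d -> S `&` `]c, d[ !=set0].

Lemma closure_inf {R : realType} (A : set R) :
  A !=set0 -> has_lbound A -> closure A (inf A).
Proof.
move=> A0 lbA B /nbhs_ballP[e /= e0 eB].
have [x Ax xe] := inf_adherent e0 (conj A0 lbA).
exists x; split=> //; apply: eB; rewrite /ball /= distrC.
by rewrite ger0_norm ?subr_ge0 ?ge_inf// ltrBlDl.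
Qed.

Lemma perfect_set_itv_neq {R : realType} (S : set R) (x a b : R) :
  perfect_set S -> S x -> x \in `]a, b[ ->
  exists y, [/\ y != x, S y & y \in `]a, b[].
Proof.
move=> [_ limS] Sx xab; rewrite -limS in Sx.
by apply: (Sx (fun z => z \in `]a, b[)); exact: near_in_itvoo.
Qed.

(** The witness is t itself or, if S has a gap ]t, e[ on the right of t, the
    infimum of the part of S beyond e: being no isolated point of S and having
    only the gap on its left, it is approached by S from the right. *)
Lemma right_limit_between {R : realType} (S : set R) (t s : R) :
  perfect_set S -> S t -> S s -> t < s ->
  exists2 c, right_limit_point S c & t <= c <= s.
Proof.
move=> pS St Ss ts; have [clS _] := pS.
have [St_right|/existsNP[e /not_implyP[te gap]]] :=
    pselect (forall d, t < d -> S `&` `]t, d[ !=set0).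
  by exists t; rewrite ?lexx ?ltW.
have out y : S y -> t < y -> e <= y.
  move=> Sy ty; rewrite leNgt; apply/negP => ye.
  by apply: gap; exists y; split=> //=; rewrite in_itv /= ty ye.
pose A := S `&` `[e, +oo[.
have As : A s by split=> //=; rewrite in_itv /= andbT out.
have lbA : has_lbound A.
  by exists e => y [_] /=; rewrite in_itv /= andbT.
have [Sc ec] : A (inf A).
  have clA : closed A by apply: closedI => //; exact: rray_closed.
  by apply: clA; apply: closure_inf => //; exists s.
have tc : t < inf A.
  by apply: (lt_le_trans te); move: ec; rewrite /= in_itv /= andbT.
exists (inf A); last by rewrite ltW//= ge_inf.
split=> // d cd.
have [|y [yc Sy]] := perfect_set_itv_neq _ _ t d pS Sc.
  by rewrite in_itv /= tc cd.
rewrite in_itv /= => /andP[ty yd].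
exists y; split=> //=; rewrite in_itv /= yd andbT lt_neqAle eq_sym yc /=.
by apply: ge_inf => //; split=> //=; rewrite in_itv /= andbT out.
Qed.

Lemma right_limit_in_itv {R : realType} (S : set R) (a b : R) :
  perfect_set S -> S `&` `]a, b[ !=set0 ->
  right_limit_point S `&` `]a, b[ !=set0.
Proof.
move=> pS [t [St tab]].
have [s [st Ss sab]] := perfect_set_itv_neq _ _ _ _ pS St tab.
move: tab sab; rewrite /= !in_itv /= => /andP[ta tb] /andP[sa sb].
have between u v : S u -> S v -> u < v -> a < u -> v < b ->
    right_limit_point S `&` `]a, b[ !=set0.
  move=> Su Sv uv au vb.
  have [c Sc /andP[uc cv]] := right_limit_between _ _ _ pS Su Sv uv.
  exists c; split=> //=.
  by rewrite in_itv /= (lt_le_trans au uc) (le_lt_trans cv vb).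
by move: st; rewrite neq_lt => /orP[/between|/between]; apply.
Qed.

Lemma perfect_set_meets_oo {R : realType} (S : set R) :
  S `<=` `[0, 1] -> S !=set0 -> perfect_set S -> S `&` `]0, 1[ !=set0.
Proof.
move=> S01 [x Sx] pS.
have [/andP[x0 x1]|xout] := boolP (0 < x < 1).
  by exists x; split=> //=; rewrite in_itv /= x0.
have [|y [yx Sy]] := perfect_set_itv_neq _ _ (x - 1) (x + 1) pS Sx.
  by rewrite in_itv /= ltrDl ltrBlDr ltrDl ltr01.
have := S01 _ Sx; have := S01 _ Sy; rewrite /= !in_itv /=.
move=> /andP[y0 y1] /andP[x0 x1] /andP[xy yx1].
exists y; split=> //=; rewrite in_itv /=.
(* [x] is 0 or 1, and [y] is within distance less than 1 of it. *)
have : x = 0 \/ x = 1.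
  move: xout; rewrite !lt_neqAle x0 x1 !andbT negb_and !negbK.
  by case/orP => /eqP; [left|right].
case=> xE; move: yx xy yx1; rewrite {}xE.
  by rewrite (add0r 1) => yn0 _ ->; rewrite lt_neqAle eq_sym yn0 y0.
by rewrite subrr => yn1 -> _; rewrite lt_neqAle yn1 y1.
Qed.

Lemma last_history {R : realType} (a b : nat -> R) (n : nat) :
  play a b -> last (0, 1) (history a b n) = (a n, b n).
Proof.
move=> [a0 b0 _]; case: n => [|n]; first by rewrite a0 b0.
by rewrite /history mkseqS last_rcons.
Qed.

Lemma legal_history_lt {R : realType} (h : seq (R * R)) :
  legal_history h -> (last (0, 1) h).1 < (last (0, 1) h).2.
Proof.
case/lastP: h => [|h p]; first by rewrite ltr01.
by rewrite /legal_history rcons_path last_rcons => /andP[_ /and3P[]].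
Qed.

(** The default value of [xget], the midpoint, keeps the rule legal on
    histories that leave no such point in the interval; for a perfect
    non-empty S inside [0, 1] they do not occur when Alice follows the rule
    from the start. *)
Definition right_limit_strategy {R : realType} (S : set R)
    (h : seq (R * R)) : R :=
  let p := last (0, 1) h in
  xget ((p.1 + p.2) / 2) (right_limit_point S `&` `]p.1, p.2[).

Lemma right_limit_strategy_legal {R : realType} (S : set R) :
  alice_strategy (right_limit_strategy S).
Proof.
move=> h /legal_history_lt lt_h; rewrite /right_limit_strategy.
case: xgetP => [x _ [_]|_]; first by rewrite /= in_itv.
by have := mid_in_itvoo lt_h; rewrite in_itv.
Qed.

Theorem proposition2 (R : realType) (S : set R)
    (S01 : S `<=` `[0, 1]) (S_neq0 : S !=set0) (S_perfect : perfect_set S) :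
  exists sigma : seq (R * R) -> R, alice_winning_strategy S sigma.
Proof.
exists (right_limit_strategy S).
split; first exact: right_limit_strategy_legal.
move=> a b ab_play ab_follows; have [a0 b0 ab] := ab_play.
have step n : S `&` `]a n, b n[ !=set0 -> right_limit_point S (a n.+1).
  move=> Sab; rewrite ab_follows /right_limit_strategy last_history//=.
  have right_ab := right_limit_in_itv _ _ _ S_perfect Sab.
  by have [] := xgetPex ((a n + b n) / 2) right_ab.
have meets n : S `&` `]a n, b n[ !=set0.
  elim: n => [|n /step[_ right_an]].
    by rewrite a0 b0; exact: perfect_set_meets_oo.
  by apply: right_an; case/and3P: (ab n).
have [clS _] := S_perfect.
apply: (closed_cvg _ clS) (play_cvg ab_play).
(* The limit only concerns a_n for n >= 1: a_0 = 0 need not be in S. *)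
by exists 1%N => // -[|n] //= _; have [] := step n (meets n).
Qed.
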